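(* For every proof term $M$ of $\mathbf{IPC}$, $M^\bullet\to^*_{\varrho\rho}M^\circ$ in $\mathbf{F}$; additionally, this reduction is fine in $\Gamma^\bullet$ if $M$ is typable in $\Gamma$. Hence, if $M$ is typable in $\Gamma$, then $M^\circ$ is the atomic normal form of $M^\bullet$ in $\Gamma^\bullet$ ($=\Gamma^\circ$), i.e. $M^\circ$ is the unique fine $\varrho\rho$-normal form in $\Gamma^\bullet$ to which $M^\bullet$ reduces by a $\varrho\rho$-reduction fine in $\Gamma^\bullet$.
   Context: **$\mathbf{IPC}$.** Types: $A,B,C::=X\mid\perp\mid A\supset B\mid A\wedge B\mid A\vee B$. Proof terms (raw, up to $\alpha$-equivalence): $x$, $\lambda x^A.M$, $MN$, $\langle M,N\rangle$, $M1$, $M2$ (projections), $\mathsf{in}_1(M,A,B)$, $\mathsf{in}_2(N,A,B)$, $\mathsf{case}(M,x^A.P,y^B.Q,C)$, $\mathsf{abort}(M,A)$. Typing is the usual natural deduction typing; $\mathsf{in}_i(M,A_1,A_2):A_1\vee A_2$ if $M:A_i$; $\Gamma\vdash\mathsf{case}(M,x^A.P,y^B.Q,C):C$ if $\Gamma\vdash M:A\vee B$, $\Gamma,x:A\vdash P:C$, $\Gamma,y:B\vdash Q:C$; $\mathsf{abort}(M,A):A$ if $M:\perp$. **System $\mathbf{F}$** (Church style, primitive conjunction). Types: $A,B::=X\mid A\supset B\mid A\wedge B\mid\forall X.A$. Terms (raw, not assumed typable, up to $\alpha$-equivalence): $x$, $\lambda x^A.M$, $MN$, $\langle M,N\rangle$,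 $M1$, $M2$, $\Lambda X.M$, $MB$ ($B$ a type). Application associates to the left; $\langle P_i\rangle_{i=1,2}$ is $\langle P_1,P_2\rangle$. Environments $\Gamma$ are sets of declarations $x:A$, each variable declared at most once. Typing: usual rules for $\supset,\wedge$; $\forall I$: from $\Gamma\vdash M:A$ infer $\Gamma\vdash\Lambda X.M:\forall X.A$ if $X$ is free in no type of $\Gamma$; $\forall E$: from $\Gamma\vdash M:\forall X.A$ infer $\Gamma\vdash MB:[B/X]A$. ''$M$ has type $A$ in $\Gamma$'' means $\Gamma\vdash M:A$ is derivable; ''typable in $\Gamma$'' means it has some type in $\Gamma$. Abbreviations: $A\,\underline{\vee}\,B:=\forall X.((A\supset X)\wedge(B\supset X))\supset X$ ($X$ not free in $A,B$), $\underline{\perp}:=\forall X.X$. $\mathbf{F}_{\mathbf{at}}$ is the fragment of $\mathbf{F}$ with the same types and with only those terms in which every universal instantiation $MB$ has $B$ a type variable. **Atomization conversions** (bound variables of the contractum chosen fresh). $\varrho$: $M(C_1\supset C_2)\langle\lambda x^A.P,\lambda y^B.Q\rangle\to\lambda z^{C_1}.MC_2\langle\lambda x^A.Pz,\lambda y^B.Qz\rangle$; $M(C_1\wedge C_2)\langle\lambda x^A.P,\lambda y^B.Q\rangle\to\langle MC_i\langle\lambda x^A.Pi,\lambda y^B.Qi\rangle\rangle_{i=1,2}$; $M(\forall Y.D)\langle\lambda x^A.P,\lambda y^B.Q\rangle\to\Lambda Y.MD\langle\lambda x^A.PY,\lambda y^B.QY\rangle$. $\rho$: $M(C_1\supset C_2)\to\lambda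 z^{C_1}.MC_2$; $M(C_1\wedge C_2)\to\langle MC_i\rangle_{i=1,2}$; $M(\forall Y.D)\to\Lambda Y.MD$. $\to_{\varrho\rho}$ is the compatible closure of $\varrho\cup\rho$, and $\to^*_{\varrho\rho}$ its reflexive-transitive closure. **Fineness.** A root $\varrho$-reduction as displayed is fine in $\Gamma$ if $M$ has type $A\,\underline{\vee}\,B$ in $\Gamma$; a root $\rho$-reduction is fine in $\Gamma$ if $M$ has type $\underline{\perp}$ in $\Gamma$. ''$M\to_{\varrho\rho}M'$ is fine in $\Gamma$'' is the ternary relation inductively generated from the fine root reductions by: if $M\to M'$ is fine in $x:A,\Gamma$ then $\lambda x^A.M\to\lambda x^A.M'$ is fine in $\Gamma$; and, if $M\to M'$ is fine in $\Gamma$, then so are $MN\to M'N$, $NM\to NM'$, $\langle M,N\rangle\to\langle M',N\rangle$, $\langle N,M\rangle\to\langle N,M'\rangle$, $Mi\to M'i$, $\Lambda X.M\to\Lambda X.M'$, $MB\to M'B$. ''$M\to_{\varrho\rho}^*M'$ is fine in $\Gamma$'' is the reflexive-transitive closure for fixed $\Gamma$. $M$ is a fine $\varrho\rho$-normal form in $\Gamma$ if $M\to_{\varrho\rho}M'$ is fine in $\Gamma$ for no $M'$. **Translations of $\mathbf{IPC}$.** On types, $A^\circ=A^\bullet$ with $X^\bullet=X$, $\perp^\bullet=\underline{\perp}$, $(A\supset B)^\bullet=A^\bullet\supset B^\bullet$, $(A\wedge B)^\bullet=A^\bullet\wedge B^\bullet$, $(A\vee B)^\bullet=A^\bullet\,\underline{\vee}\,B^\bullet$;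 $\Gamma^\bullet$ translates all types in $\Gamma$. On terms both maps are homomorphic on variables, $\lambda$ (translating the annotation), application, pairs and projections. Russell-Prawitz map into $\mathbf{F}$: $(\mathsf{in}_i(M,A,B))^\bullet=\Lambda X.\lambda w^{(A^\bullet\supset X)\wedge(B^\bullet\supset X)}.(w\,i)M^\bullet$ ($X$, $w$ fresh), $(\mathsf{case}(M,x^A.P,y^B.Q,C))^\bullet=M^\bullet C^\bullet\langle\lambda x^{A^\bullet}.P^\bullet,\lambda y^{B^\bullet}.Q^\bullet\rangle$, $(\mathsf{abort}(M,A))^\bullet=M^\bullet A^\bullet$. Map into $\mathbf{F}_{\mathbf{at}}$: $(\mathsf{in}_i(M,A,B))^\circ=\Lambda X.\lambda w^{(A^\circ\supset X)\wedge(B^\circ\supset X)}.(w\,i)M^\circ$, $(\mathsf{case}(M,x^A.P,y^B.Q,C))^\circ=\underline{\mathtt{case}}(M^\circ,x^{A^\circ}.P^\circ,y^{B^\circ}.Q^\circ,C^\circ)$, $(\mathsf{abort}(M,A))^\circ=\underline{\mathtt{abort}}(M^\circ,A^\circ)$, where (bound variables $z$, $X$ fresh) $\underline{\mathtt{case}}$ is defined by recursion on its last argument: $\underline{\mathtt{case}}(M,x^A.P,y^B.Q,X)=MX\langle\lambda x^A.P,\lambda y^B.Q\rangle$; $\underline{\mathtt{case}}(M,x^A.P,y^B.Q,C_1\wedge C_2)=\langle\underline{\mathtt{case}}(M,x^A.Pi,y^B.Qi,C_i)\rangle_{i=1,2}$; $\underline{\mathtt{case}}(M,x^A.P,y^B.Q,C\supset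 D)=\lambda z^C.\underline{\mathtt{case}}(M,x^A.Pz,y^B.Qz,D)$; $\underline{\mathtt{case}}(M,x^A.P,y^B.Q,\forall X.C)=\Lambda X.\underline{\mathtt{case}}(M,x^A.PX,y^B.QX,C)$; and $\underline{\mathtt{abort}}(M,X)=MX$, $\underline{\mathtt{abort}}(M,A_1\wedge A_2)=\langle\underline{\mathtt{abort}}(M,A_1),\underline{\mathtt{abort}}(M,A_2)\rangle$, $\underline{\mathtt{abort}}(M,B\supset C)=\lambda z^B.\underline{\mathtt{abort}}(M,C)$, $\underline{\mathtt{abort}}(M,\forall X.A)=\Lambda X.\underline{\mathtt{abort}}(M,A)$. *)

(* Defs.v *)
From Stdlib Require Import List PeanoNat Relations.

(* Stdlib only.

   Alpha-equivalence classes are represented by de Bruijn terms with two separate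
   index spaces, one for type variables and one for term variables.  An index that
   points outside all binders is a free variable.  An environment is the list of the
   types of the term variables 0, 1, 2, ... ; indices beyond its length are undeclared. *)

Inductive side : Set := one | two.

Definition sel {T : Type} (i : side) (a b : T) : T :=
  match i with one => a | two => b end.

Definition scons {T : Type} (a : T) (s : nat -> T) (n : nat) : T :=
  match n with 0 => a | S m => s m end.

Definition up_ren (xi : nat -> nat) : nat -> nat := scons 0 (fun n => S (xi n)).

(** * System F *)

Inductive ty : Set :=
| TVar (X : nat)
| TImp (A B : ty)
| TAnd (A B : ty)
| TAll (A : ty).

Fixpoint ren_ty (xi : nat -> nat) (A : ty) : ty :=
  match A with
  | TVar X => TVar (xi X)
  | TImp A B => TImp (ren_ty xi A) (ren_ty xi B)
  | TAnd A B => TAnd (ren_ty xi A) (ren_ty xi B)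
  | TAll A => TAll (ren_ty (up_ren xi) A)
  end.

Definition shift_ty : ty -> ty := ren_ty S.

Definition up_sub (s : nat -> ty) : nat -> ty :=
  scons (TVar 0) (fun n => shift_ty (s n)).

Fixpoint subst_ty (s : nat -> ty) (A : ty) : ty :=
  match A with
  | TVar X => s X
  | TImp A B => TImp (subst_ty s A) (subst_ty s B)
  | TAnd A B => TAnd (subst_ty s A) (subst_ty s B)
  | TAll A => TAll (subst_ty (up_sub s) A)
  end.

(* [B/X]A, where A is the body of [TAll A] *)
Definition inst_ty (B A : ty) : ty := subst_ty (scons B TVar) A.

(* ((A => X) /\ (B => X)) with X the fresh type variable of index 0 *)
Definition elim_ty (A B : ty) : ty :=
  TAnd (TImp (shift_ty A) (TVar 0)) (TImp (shift_ty B) (TVar 0)).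

Definition TOr (A B : ty) : ty := TAll (TImp (elim_ty A B) (TVar 0)).

Definition TBot : ty := TAll (TVar 0).

Inductive tm : Set :=
| Var (x : nat)
| Lam (A : ty) (M : tm)
| App (M N : tm)
| Pair (M N : tm)
| Proj (M : tm) (i : side)
| TLam (M : tm)
| TApp (M : tm) (B : ty).

(* [xi] renames the free type variables and [zeta] the free term variables. *)
Fixpoint ren_tm (xi zeta : nat -> nat) (M : tm) : tm :=
  match M with
  | Var x => Var (zeta x)
  | Lam A M => Lam (ren_ty xi A) (ren_tm xi (up_ren zeta) M)
  | App M N => App (ren_tm xi zeta M) (ren_tm xi zeta N)
  | Pair M N => Pair (ren_tm xi zeta M) (ren_tm xi zeta N)
  | Proj M i => Proj (ren_tm xi zeta M) i
  | TLam M => TLam (ren_tm (up_ren xi) zeta M)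
  | TApp M B => TApp (ren_tm xi zeta M) (ren_ty xi B)
  end.

(* Weakening by one fresh type variable, resp. one fresh term variable.  [shift1_tm]
   weakens the body of an abstraction, leaving the abstracted variable at index 0 and
   putting the fresh variable at index 1. *)
Definition tshift_tm : tm -> tm := ren_tm S (fun x => x).
Definition shift_tm : tm -> tm := ren_tm (fun X => X) S.
Definition shift1_tm : tm -> tm := ren_tm (fun X => X) (up_ren S).

(* Abstraction over the free type variable numbered [X]. *)
Definition bind (X Y : nat) : nat := if Nat.eqb Y X then 0 else S Y.
Definition TLam_at (X : nat) (M : tm) : tm :=
  TLam (ren_tm (bind X) (fun x => x) M).

Definition env : Set := list ty.

Inductive typed : env -> tm -> ty -> Prop :=
| typed_var G x A :
    nth_error G x = Some A -> typed G (Var x) A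
| typed_lam G A B M :
    typed (A :: G) M B -> typed G (Lam A M) (TImp A B)
| typed_app G A B M N :
    typed G M (TImp A B) -> typed G N A -> typed G (App M N) B
| typed_pair G A B M N :
    typed G M A -> typed G N B -> typed G (Pair M N) (TAnd A B)
| typed_proj G A B M i :
    typed G M (TAnd A B) -> typed G (Proj M i) (sel i A B)
| typed_tlam G A M :
    typed (map shift_ty G) M A -> typed G (TLam M) (TAll A)
| typed_tapp G A M B :
    typed G M (TAll A) -> typed G (TApp M B) (inst_ty B A).

(** * Atomization conversions *)

(* [varrho M A B N N'] : N -> N' is a root conversion whose redex has head [M] and
   whose two branches are abstractions annotated by [A] and [B]. *)
Inductive varrho (M : tm) (A B : ty) : tm -> tm -> Prop :=
| varrho_imp C1 C2 P Q :
    varrho M A B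
      (App (TApp M (TImp C1 C2)) (Pair (Lam A P) (Lam B Q)))
      (Lam C1 (App (TApp (shift_tm M) C2)
                   (Pair (Lam A (App (shift1_tm P) (Var 1)))
                         (Lam B (App (shift1_tm Q) (Var 1))))))
| varrho_and C1 C2 P Q :
    varrho M A B
      (App (TApp M (TAnd C1 C2)) (Pair (Lam A P) (Lam B Q)))
      (Pair (App (TApp M C1) (Pair (Lam A (Proj P one)) (Lam B (Proj Q one))))
            (App (TApp M C2) (Pair (Lam A (Proj P two)) (Lam B (Proj Q two)))))
| varrho_all D P Q :
    varrho M A B
      (App (TApp M (TAll D)) (Pair (Lam A P) (Lam B Q)))
      (TLam (App (TApp (tshift_tm M) D)
                 (Pair (Lam (shift_ty A) (TApp (tshift_tm P) (TVar 0)))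
                       (Lam (shift_ty B) (TApp (tshift_tm Q) (TVar 0)))))).

Inductive rho (M : tm) : tm -> tm -> Prop :=
| rho_imp C1 C2 :
    rho M (TApp M (TImp C1 C2)) (Lam C1 (TApp (shift_tm M) C2))
| rho_and C1 C2 :
    rho M (TApp M (TAnd C1 C2)) (Pair (TApp M C1) (TApp M C2))
| rho_all D :
    rho M (TApp M (TAll D)) (TLam (TApp (tshift_tm M) D)).

Inductive step : tm -> tm -> Prop :=
| step_varrho M A B N N' : varrho M A B N N' -> step N N'
| step_rho M N N' : rho M N N' -> step N N'
| step_lam A M M' : step M M' -> step (Lam A M) (Lam A M')
| step_appl M M' N : step M M' -> step (App M N) (App M' N)
| step_appr M M' N : step M M' -> step (App N M) (App N M')
| step_pairl M M' N : step M M' -> step (Pair M N) (Pair M' N)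
| step_pairr M M' N : step M M' -> step (Pair N M) (Pair N M')
| step_proj M M' i : step M M' -> step (Proj M i) (Proj M' i)
| step_tlam M M' : step M M' -> step (TLam M) (TLam M')
| step_tapp M M' B : step M M' -> step (TApp M B) (TApp M' B).

Definition steps : tm -> tm -> Prop := clos_refl_trans tm step.

(** * Fineness *)

(* In [fine_tlam] the environment is the same above and below, and the abstracted type
   variable [X] is not required to be fresh for it.  Taking [X] fresh gives the rule
   from [fine (map shift_ty G) M M'] to [fine G (TLam M) (TLam M')]. *)
Inductive fine : env -> tm -> tm -> Prop :=
| fine_varrho G M A B N N' :
    typed G M (TOr A B) -> varrho M A B N N' -> fine G N N'
| fine_rho G M N N' :
    typed G M TBot -> rho M N N' -> fine G N N'
| fine_lam G A M M' :
    fine (A :: G) M M' -> fine G (Lam A M) (Lam A M')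
| fine_appl G M M' N : fine G M M' -> fine G (App M N) (App M' N)
| fine_appr G M M' N : fine G M M' -> fine G (App N M) (App N M')
| fine_pairl G M M' N : fine G M M' -> fine G (Pair M N) (Pair M' N)
| fine_pairr G M M' N : fine G M M' -> fine G (Pair N M) (Pair N M')
| fine_proj G M M' i : fine G M M' -> fine G (Proj M i) (Proj M' i)
| fine_tlam G X M M' :
    fine G M M' -> fine G (TLam_at X M) (TLam_at X M')
| fine_tapp G M M' B : fine G M M' -> fine G (TApp M B) (TApp M' B).

Definition fine_steps (G : env) : tm -> tm -> Prop := clos_refl_trans tm (fine G).

Definition fine_nf (G : env) (M : tm) : Prop := forall M', ~ fine G M M'.

Definition is_atomic_nf (G : env) (M N : tm) : Prop :=
  unique (fun N' => fine_steps G M N' /\ fine_nf G N') N.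

(** * IPC *)

Inductive ipc_ty : Set :=
| IVar (X : nat)
| IBot
| IImp (A B : ipc_ty)
| IAnd (A B : ipc_ty)
| IOr (A B : ipc_ty).

(* [P] and [Q] in [PCase M A P B Q C] are each in the scope of one more term variable. *)
Inductive proof : Set :=
| PVar (x : nat)
| PLam (A : ipc_ty) (M : proof)
| PApp (M N : proof)
| PPair (M N : proof)
| PProj (M : proof) (i : side)
| PInj (i : side) (M : proof) (A B : ipc_ty)
| PCase (M : proof) (A : ipc_ty) (P : proof) (B : ipc_ty) (Q : proof) (C : ipc_ty)
| PAbort (M : proof) (A : ipc_ty).

Definition ipc_env : Set := list ipc_ty.

Inductive ipc_typed : ipc_env -> proof -> ipc_ty -> Prop :=
| ipc_typed_var G x A :
    nth_error G x = Some A -> ipc_typed G (PVar x) A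
| ipc_typed_lam G A B M :
    ipc_typed (A :: G) M B -> ipc_typed G (PLam A M) (IImp A B)
| ipc_typed_app G A B M N :
    ipc_typed G M (IImp A B) -> ipc_typed G N A -> ipc_typed G (PApp M N) B
| ipc_typed_pair G A B M N :
    ipc_typed G M A -> ipc_typed G N B -> ipc_typed G (PPair M N) (IAnd A B)
| ipc_typed_proj G A B M i :
    ipc_typed G M (IAnd A B) -> ipc_typed G (PProj M i) (sel i A B)
| ipc_typed_inj G A B M i :
    ipc_typed G M (sel i A B) -> ipc_typed G (PInj i M A B) (IOr A B)
| ipc_typed_case G A B C M P Q :
    ipc_typed G M (IOr A B) ->
    ipc_typed (A :: G) P C ->
    ipc_typed (B :: G) Q C ->
    ipc_typed G (PCase M A P B Q C) C
| ipc_typed_abort G A M :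
    ipc_typed G M IBot -> ipc_typed G (PAbort M A) A.

Definition ipc_typable (G : ipc_env) (M : proof) : Prop :=
  exists A, ipc_typed G M A.

(** * Translations *)

(* The two translations agree on types, so one function serves for both. *)
Fixpoint tr_ty (A : ipc_ty) : ty :=
  match A with
  | IVar X => TVar X
  | IBot => TBot
  | IImp A B => TImp (tr_ty A) (tr_ty B)
  | IAnd A B => TAnd (tr_ty A) (tr_ty B)
  | IOr A B => TOr (tr_ty A) (tr_ty B)
  end.

Definition tr_env (G : ipc_env) : env := map tr_ty G.

Definition tr_inj (i : side) (M : tm) (A B : ty) : tm :=
  TLam (Lam (elim_ty A B) (App (Proj (Var 0) i) (shift_tm (tshift_tm M)))).

(* Russell-Prawitz *)
Fixpoint bullet (M : proof) : tm :=
  match M with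
  | PVar x => Var x
  | PLam A M => Lam (tr_ty A) (bullet M)
  | PApp M N => App (bullet M) (bullet N)
  | PPair M N => Pair (bullet M) (bullet N)
  | PProj M i => Proj (bullet M) i
  | PInj i M A B => tr_inj i (bullet M) (tr_ty A) (tr_ty B)
  | PCase M A P B Q C =>
      App (TApp (bullet M) (tr_ty C))
          (Pair (Lam (tr_ty A) (bullet P)) (Lam (tr_ty B) (bullet Q)))
  | PAbort M A => TApp (bullet M) (tr_ty A)
  end.

(* [P] and [Q] are bodies, in the scope of the variable of type [A], resp. [B]. *)
Fixpoint case_at (M : tm) (A : ty) (P : tm) (B : ty) (Q : tm) (C : ty) : tm :=
  match C with
  | TVar X => App (TApp M (TVar X)) (Pair (Lam A P) (Lam B Q))
  | TAnd C1 C2 =>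
      Pair (case_at M A (Proj P one) B (Proj Q one) C1)
           (case_at M A (Proj P two) B (Proj Q two) C2)
  | TImp C D =>
      Lam C (case_at (shift_tm M)
                     A (App (shift1_tm P) (Var 1))
                     B (App (shift1_tm Q) (Var 1)) D)
  | TAll C =>
      TLam (case_at (tshift_tm M)
                    (shift_ty A) (TApp (tshift_tm P) (TVar 0))
                    (shift_ty B) (TApp (tshift_tm Q) (TVar 0)) C)
  end.

Fixpoint abort_at (M : tm) (A : ty) : tm :=
  match A with
  | TVar X => TApp M (TVar X)
  | TAnd A1 A2 => Pair (abort_at M A1) (abort_at M A2)
  | TImp B C => Lam B (abort_at (shift_tm M) C)
  | TAll A => TLam (abort_at (tshift_tm M) A)
  end.

(* The translation into the atomic fragment *)
Fixpoint circ (M : proof) : tm :=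
  match M with
  | PVar x => Var x
  | PLam A M => Lam (tr_ty A) (circ M)
  | PApp M N => App (circ M) (circ N)
  | PPair M N => Pair (circ M) (circ N)
  | PProj M i => Proj (circ M) i
  | PInj i M A B => tr_inj i (circ M) (tr_ty A) (tr_ty B)
  | PCase M A P B Q C =>
      case_at (circ M) (tr_ty A) (circ P) (tr_ty B) (circ Q) (tr_ty C)
  | PAbort M A => abort_at (circ M) (tr_ty A)
  end.

(* Main.v *)
(** The redexes whose heads have type [TOr] or [TBot] form an orthogonal system: contraction
    never destroys the type annotations and constructors that make up another redex, and
    it creates redexes only in a way that a bottom-up traversal of the term foresees.  So
    the atomic normal form of a typed term is a function [nf] of the term, constant along
    fine reductions and equal to the identity on fine normal forms.  As [bullet M]
    finely reduces to [circ M], which instantiates only with type variables and so is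
    fine normal, every other fine normal form of [bullet M] is equal to [circ M]. *)

From Stdlib Require Import List Arith Lia Relations.
Require Import Defs.

(** * Renaming of types *)

Lemma up_ren_ext (f g : nat -> nat) :
  (forall n, f n = g n) -> forall n, up_ren f n = up_ren g n.
Proof. intros H [|n]; simpl; auto. Qed.

Lemma up_ren_comp (f g : nat -> nat) n :
  up_ren f (up_ren g n) = up_ren (fun m => f (g m)) n.
Proof. now destruct n. Qed.

Lemma up_ren_id n : up_ren (fun m => m) n = n.
Proof. now destruct n. Qed.

Lemma ren_ty_ext A : forall f g, (forall n, f n = g n) -> ren_ty f A = ren_ty g A.
Proof. induction A; simpl; intros; f_equal; auto using up_ren_ext. Qed.

Lemma ren_ty_comp A : forall f g,
  ren_ty f (ren_ty g A) = ren_ty (fun n => f (g n)) A.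
Proof.
  induction A; simpl; intros f g; f_equal; auto.
  rewrite IHA. apply ren_ty_ext, up_ren_comp.
Qed.

Lemma ren_ty_id A : forall f, (forall n, f n = n) -> ren_ty f A = A.
Proof.
  induction A; simpl; intros f Hf; f_equal; auto.
  apply IHA. intros [|n]; simpl; auto.
Qed.

Lemma ren_ty_shift xi A : ren_ty (up_ren xi) (shift_ty A) = shift_ty (ren_ty xi A).
Proof. unfold shift_ty. now rewrite !ren_ty_comp. Qed.

Lemma ren_ty_or xi A B : ren_ty xi (TOr A B) = TOr (ren_ty xi A) (ren_ty xi B).
Proof. unfold TOr, elim_ty. simpl. now rewrite !ren_ty_shift. Qed.

Lemma up_sub_ext s t : (forall n, s n = t n) -> forall n, up_sub s n = up_sub t n.
Proof. intros H [|n]; unfold up_sub; simpl; f_equal; auto. Qed.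

Lemma subst_ty_ext A : forall s t, (forall n, s n = t n) -> subst_ty s A = subst_ty t A.
Proof. induction A; simpl; intros; f_equal; auto using up_sub_ext. Qed.

Lemma subst_ty_id A : forall s, (forall n, s n = TVar n) -> subst_ty s A = A.
Proof.
  induction A; simpl; intros s Hs; f_equal; auto.
  apply IHA. intros [|n]; unfold up_sub; simpl; auto. now rewrite Hs.
Qed.

Lemma subst_ren_ty A : forall s f,
  subst_ty s (ren_ty f A) = subst_ty (fun n => s (f n)) A.
Proof.
  induction A; simpl; intros s f; f_equal; auto.
  rewrite IHA. apply subst_ty_ext. intros [|n]; reflexivity.
Qed.

Lemma ren_subst_ty A : forall s f,
  ren_ty f (subst_ty s A) = subst_ty (fun n => ren_ty f (s n)) A.
Proof.
  induction A; simpl; intros s f; f_equal; auto.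
  rewrite IHA. apply subst_ty_ext. intros [|n]; unfold up_sub; simpl; auto.
  apply ren_ty_shift.
Qed.

Lemma ren_inst_ty xi A B :
  ren_ty xi (inst_ty B A) = inst_ty (ren_ty xi B) (ren_ty (up_ren xi) A).
Proof.
  unfold inst_ty. rewrite ren_subst_ty, subst_ren_ty.
  apply subst_ty_ext. intros [|n]; reflexivity.
Qed.

Lemma inst_shift_ty A B : inst_ty B (shift_ty A) = A.
Proof. unfold inst_ty, shift_ty. rewrite subst_ren_ty. now apply subst_ty_id. Qed.

(** This is the shape of the types arising in [varrho_all], where a weakened branch of type [TAll D]
    is instantiated with the freshly bound variable. *)
Lemma inst_var_ty A : inst_ty (TVar 0) (ren_ty (up_ren S) A) = A.
Proof.
  unfold inst_ty. rewrite subst_ren_ty. apply subst_ty_id. intros [|n]; reflexivity.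
Qed.

Lemma inst_elim_ty A B C : inst_ty C (elim_ty A B) = TAnd (TImp A C) (TImp B C).
Proof.
  unfold elim_ty. change (TAnd (TImp (inst_ty C (shift_ty A)) C)
    (TImp (inst_ty C (shift_ty B)) C) = TAnd (TImp A C) (TImp B C)).
  now rewrite !inst_shift_ty.
Qed.

(** The hypothesis, that every index sent by [f] into the range of [g] is in the range of [h],
    survives passing under [TAll], as all lifted renamings fix 0 and send only 0 to 0. It serves to
    transfer freshness of a variable backwards along a renaming. *)
Lemma ren_ty_pullback A : forall A' f g h,
  (forall n m, f n = g m -> exists p, n = h p) ->
  ren_ty f A = ren_ty g A' -> exists A1, A = ren_ty h A1.
Proof.
  induction A; intros A' f g h H; destruct A'; simpl; intros E;
    try discriminate E; injection E.
  - intros E'. destruct (H _ _ E') as [p ->]. now exists (TVar p).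
  - intros E2 E1. destruct (IHA1 _ _ _ _ H E1) as [B1 ->].
    destruct (IHA2 _ _ _ _ H E2) as [B2 ->]. now exists (TImp B1 B2).
  - intros E2 E1. destruct (IHA1 _ _ _ _ H E1) as [B1 ->].
    destruct (IHA2 _ _ _ _ H E2) as [B2 ->]. now exists (TAnd B1 B2).
  - intros E1. destruct (IHA A' (up_ren f) (up_ren g) (up_ren h)) as [B1 ->]; auto.
    + intros [|n] [|m]; cbn; intros Em; try discriminate.
      * now exists 0.
      * injection Em as Em. destruct (H _ _ Em) as [p ->]. now exists (S p).
    + now exists (TAll B1).
Qed.

(** Even a renaming that identifies variables cannot create a disjunction: under the quantifier only
    0 is sent to 0, so the bound variable occurs where it did before and no free variable is
    captured. *)
Lemma ren_ty_or_inv xi T A B :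
  ren_ty xi T = TOr A B -> exists A1 B1, T = TOr A1 B1.
Proof.
  assert (F : forall A0 A', ren_ty (up_ren xi) A0 = shift_ty A' ->
                       exists A1, A0 = shift_ty A1).
  { intros A0 A'. apply ren_ty_pullback. intros [|n] m; cbn; intros E; [discriminate|].
    now exists n. }
  destruct T as [| | |T]; simpl; intros E; try discriminate E. injection E as E.
  destruct T as [|T T0| |]; simpl in E; try discriminate E. injection E as E E0.
  destruct T0 as [[|X0]| | |]; try discriminate E0.
  destruct T as [| |T1 T2|]; simpl in E; try discriminate E. injection E as E1 E2.
  destruct T1 as [|T1 U1| |]; simpl in E1; try discriminate E1. injection E1 as E1 F1.
  destruct T2 as [|T2 U2| |]; simpl in E2; try discriminate E2. injection E2 as E2 F2.
  destruct U1 as [[|U1]| | |]; try discriminate F1.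
  destruct U2 as [[|U2]| | |]; try discriminate F2.
  destruct (F _ _ E1) as [A1 ->], (F _ _ E2) as [B1 ->].
  now exists A1, B1.
Qed.

(** * Renaming of terms *)

Lemma ren_tm_ext M : forall f g h k,
  (forall n, f n = g n) -> (forall n, h n = k n) -> ren_tm f h M = ren_tm g k M.
Proof. induction M; simpl; intros; f_equal; auto using up_ren_ext, ren_ty_ext. Qed.

Lemma ren_tm_comp M : forall f g h k,
  ren_tm f h (ren_tm g k M) = ren_tm (fun n => f (g n)) (fun n => h (k n)) M.
Proof.
  induction M; simpl; intros f g h k; f_equal; auto using ren_ty_comp.
  - rewrite IHM. apply ren_tm_ext; auto using up_ren_comp.
  - rewrite IHM. apply ren_tm_ext; auto using up_ren_comp.
Qed.

Lemma ren_tm_id M : forall f h,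
  (forall n, f n = n) -> (forall n, h n = n) -> ren_tm f h M = M.
Proof.
  induction M; simpl; intros f h Hf Hh; f_equal; auto using ren_ty_id.
  - apply IHM; auto. intros [|n]; cbn; auto.
  - apply IHM; auto. intros [|n]; cbn; auto.
Qed.

Lemma ren_shift xi zeta M :
  ren_tm xi (up_ren zeta) (shift_tm M) = shift_tm (ren_tm xi zeta M).
Proof. unfold shift_tm. now rewrite !ren_tm_comp. Qed.

Lemma ren_shift1 xi zeta M :
  ren_tm xi (up_ren (up_ren zeta)) (shift1_tm M) = shift1_tm (ren_tm xi (up_ren zeta) M).
Proof.
  unfold shift1_tm. rewrite !ren_tm_comp. apply ren_tm_ext; intros [|n]; reflexivity.
Qed.

Lemma ren_tshift xi zeta M :
  ren_tm (up_ren xi) zeta (tshift_tm M) = tshift_tm (ren_tm xi zeta M).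
Proof. unfold tshift_tm. now rewrite !ren_tm_comp. Qed.

Lemma ren_case_at C : forall xi zeta M A P B Q,
  ren_tm xi zeta (case_at M A P B Q C) =
  case_at (ren_tm xi zeta M) (ren_ty xi A) (ren_tm xi (up_ren zeta) P)
    (ren_ty xi B) (ren_tm xi (up_ren zeta) Q) (ren_ty xi C).
Proof.
  induction C; simpl; intros; f_equal; auto.
  - rewrite IHC2. simpl. now rewrite !ren_shift1, ren_shift.
  - rewrite IHC. simpl. now rewrite !ren_tshift, !ren_ty_shift.
Qed.

Lemma ren_abort_at C : forall xi zeta M,
  ren_tm xi zeta (abort_at M C) = abort_at (ren_tm xi zeta M) (ren_ty xi C).
Proof.
  induction C; simpl; intros; f_equal; auto.
  - now rewrite IHC2, ren_shift.
  - now rewrite IHC, ren_tshift.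
Qed.

Lemma ren_varrho xi zeta M A B N N' : varrho M A B N N' ->
  varrho (ren_tm xi zeta M) (ren_ty xi A) (ren_ty xi B)
    (ren_tm xi zeta N) (ren_tm xi zeta N').
Proof.
  intros []; cbn [ren_tm ren_ty].
  - rewrite !ren_shift1, ren_shift. constructor.
  - constructor.
  - rewrite !ren_tshift, !ren_ty_shift. constructor.
Qed.

Lemma ren_rho xi zeta M N N' : rho M N N' ->
  rho (ren_tm xi zeta M) (ren_tm xi zeta N) (ren_tm xi zeta N').
Proof.
  intros []; cbn [ren_tm ren_ty]; rewrite ?ren_shift, ?ren_tshift; constructor.
Qed.

(** Required for injections, whose argument sits under two weakenings in [tr_inj]. *)
Lemma step_ren M M' : step M M' ->
  forall xi zeta, step (ren_tm xi zeta M) (ren_tm xi zeta M').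
Proof.
  induction 1; intros xi zeta; simpl;
    eauto using step, ren_varrho, ren_rho.
Qed.

(** * Typing *)

Definition ren_env (xi zeta : nat -> nat) (G G' : env) : Prop :=
  forall x A, nth_error G x = Some A -> nth_error G' (zeta x) = Some (ren_ty xi A).

Lemma ren_env_up xi zeta G G' A :
  ren_env xi zeta G G' -> ren_env xi (up_ren zeta) (A :: G) (ren_ty xi A :: G').
Proof. intros H [|x] B; cbn; auto. intros [=]. now subst. Qed.

Lemma ren_env_shift xi zeta G G' :
  ren_env xi zeta G G' -> ren_env (up_ren xi) zeta (map shift_ty G) (map shift_ty G').
Proof.
  intros H x A. rewrite !nth_error_map.
  destruct (nth_error G x) as [B|] eqn:E; simpl; intros [=]. subst.
  rewrite (H _ _ E), ren_ty_shift. reflexivity.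
Qed.

Lemma ren_env_weaken G A : ren_env (fun X => X) S G (A :: G).
Proof. intros x B E. cbn. now rewrite ren_ty_id, E. Qed.

Lemma ren_env_tweaken xi G : ren_env xi (fun x => x) G (map (ren_ty xi) G).
Proof. intros x B E. now rewrite nth_error_map, E. Qed.

Lemma ren_env_weaken1 G A B : ren_env (fun X => X) (up_ren S) (A :: G) (A :: B :: G).
Proof.
  rewrite <- (ren_ty_id A (fun X => X)) at 2 by auto. apply ren_env_up, ren_env_weaken.
Qed.

Lemma typed_ren G M A : typed G M A -> forall xi zeta G', ren_env xi zeta G G' ->
  typed G' (ren_tm xi zeta M) (ren_ty xi A).
Proof.
  induction 1; simpl; intros xi zeta G' HG.
  - constructor. auto.
  - constructor. apply IHtyped. now apply ren_env_up.
  - econstructor; [apply IHtyped1 | apply IHtyped2]; auto.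
  - constructor; auto.
  - replace (ren_ty xi (sel i A B)) with (sel i (ren_ty xi A) (ren_ty xi B))
      by now destruct i.
    constructor. now apply IHtyped.
  - constructor. apply IHtyped. now apply ren_env_shift.
  - rewrite ren_inst_ty. constructor. now apply IHtyped.
Qed.

Lemma typed_shift G M A B : typed G M A -> typed (B :: G) (shift_tm M) A.
Proof.
  intros H. rewrite <- (ren_ty_id A (fun X => X)) by auto.
  eapply typed_ren; eauto using ren_env_weaken.
Qed.

Lemma typed_shift1 G M A B C :
  typed (B :: G) M A -> typed (B :: C :: G) (shift1_tm M) A.
Proof.
  intros H. rewrite <- (ren_ty_id A (fun X => X)) by auto.
  eapply typed_ren; eauto using ren_env_weaken1.
Qed.

Lemma typed_tshift G M A : typed G M A -> typed (map shift_ty G) (tshift_tm M) (shift_ty A).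
Proof. intros H. eapply typed_ren; eauto using ren_env_tweaken. Qed.

(** Type reconstruction made total by the arbitrary default [TBot]; its values are meaningful on
    typed terms only. Being a function, it lets [nf] consult types by computation. *)
Fixpoint infer (G : env) (M : tm) : ty :=
  match M with
  | Var x => nth x G TBot
  | Lam A M => TImp A (infer (A :: G) M)
  | App M N => match infer G M with TImp _ B => B | _ => TBot end
  | Pair M N => TAnd (infer G M) (infer G N)
  | Proj M i => match infer G M with TAnd A B => sel i A B | _ => TBot end
  | TLam M => TAll (infer (map shift_ty G) M)
  | TApp M B => match infer G M with TAll A => inst_ty B A | _ => TBot end
  end.

Lemma infer_typed G M A : typed G M A -> infer G M = A.
Proof.
  induction 1; simpl.
  - now apply nth_error_nth.
  - now rewrite IHtyped.
  - now rewrite IHtyped1.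
  - now rewrite IHtyped1, IHtyped2.
  - now rewrite IHtyped.
  - now rewrite IHtyped.
  - now rewrite IHtyped.
Qed.

Lemma typed_unique G M A B : typed G M A -> typed G M B -> A = B.
Proof. intros HA HB. rewrite <- (infer_typed _ _ _ HA). now apply infer_typed. Qed.

(** * Subject reduction for root conversions *)

Ltac inv_typed :=
  match goal with
  | H : typed _ (Lam _ _) _ |- _ => inversion H; clear H; subst
  | H : typed _ (App _ _) _ |- _ => inversion H; clear H; subst
  | H : typed _ (Pair _ _) _ |- _ => inversion H; clear H; subst
  | H : typed _ (Proj _ _) _ |- _ => inversion H; clear H; subst
  | H : typed _ (TLam _) _ |- _ => inversion H; clear H; subst
  | H : typed _ (TApp _ _) _ |- _ => inversion H; clear H; subst
  | H : typed _ (Var _) _ |- _ => inversion H; clear H; subst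
  end.

Lemma typed_or_elim G M A B C R : typed G M (TOr A B) ->
  typed G R (TAnd (TImp A C) (TImp B C)) -> typed G (App (TApp M C) R) C.
Proof.
  intros HM HR. eapply typed_app; [|exact HR].
  rewrite <- inst_elim_ty.
  change (TImp (inst_ty C (elim_ty A B)) C) with (inst_ty C (TImp (elim_ty A B) (TVar 0))).
  now constructor.
Qed.

Lemma typed_or_elim_inv G M A B C R T : typed G M (TOr A B) ->
  typed G (App (TApp M C) R) T -> T = C /\ typed G R (TAnd (TImp A C) (TImp B C)).
Proof.
  intros HM HR. do 2 inv_typed.
  match goal with H : typed G M (TAll _) |- _ =>
    pose proof (typed_unique _ _ _ _ HM H) as E end.
  injection E as <-.
  match goal with H : _ = TImp _ _ |- _ => rename H into E end.
  change (TImp (inst_ty C (elim_ty A B)) C = TImp A0 T) in E.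
  rewrite inst_elim_ty in E. injection E as <- <-. auto.
Qed.

Lemma typed_varrho G M A B N N' T :
  typed G M (TOr A B) -> varrho M A B N N' -> typed G N T -> typed G N' T.
Proof.
  intros HM HN HT.
  assert (HS : typed (map shift_ty G) (tshift_tm M) (TOr (shift_ty A) (shift_ty B))).
  { unfold shift_ty at 2 3. rewrite <- ren_ty_or. now apply typed_tshift. }
  destruct HN; apply (typed_or_elim_inv _ _ _ _ _ _ _ HM) in HT;
    destruct HT as [-> HR]; repeat inv_typed.
  - constructor. eapply typed_or_elim; [eapply typed_shift; eassumption|].
    repeat (econstructor; eauto using typed_shift1).
  - constructor; (eapply typed_or_elim; [eassumption|]);
      repeat constructor.
    + now apply typed_proj with (i := one) (A := C1) (B := C2).
    + now apply typed_proj with (i := one) (A := C1) (B := C2).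
    + now apply typed_proj with (i := two) (A := C1) (B := C2).
    + now apply typed_proj with (i := two) (A := C1) (B := C2).
  - constructor. eapply typed_or_elim; [eassumption|].
    (* The branches of the contractum instantiate a weakened [TAll D] with variable 0, so typing
       yields their codomain in this instantiated form. *)
    rewrite <- (inst_var_ty D) at 1 2.
    repeat constructor; eapply (typed_tshift (_ :: _) _ (TAll D)); eassumption.
Qed.

Lemma typed_bot_elim G M C : typed G M TBot -> typed G (TApp M C) C.
Proof. intros H. now apply (typed_tapp G (TVar 0)). Qed.

Lemma typed_rho G M N N' T :
  typed G M TBot -> rho M N N' -> typed G N T -> typed G N' T.
Proof.
  intros HM HN HT.
  destruct HN; rewrite (typed_unique _ _ _ _ HT (typed_bot_elim _ _ _ HM));
    constructor; apply typed_bot_elim; auto using typed_shift.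
  now apply (typed_tshift _ _ TBot).
Qed.

(** * Atomization *)

Definition eq_ty_dec (A B : ty) : {A = B} + {A <> B}.
Proof. decide equality. apply Nat.eq_dec. Defined.

(** A type lies in the image of the shift exactly when variable 0 is fresh for it, which is what
    recognizing a [TOr] has to decide. An arbitrary [f] makes the induction pass under [TAll]. *)
Lemma ren_ty_image_dec A : forall f,
  (forall n, {m | n = f m} + {forall m, n <> f m}) ->
  {A' | A = ren_ty f A'} + {forall A', A <> ren_ty f A'}.
Proof.
  induction A as [X|A1 IH1 A2 IH2|A1 IH1 A2 IH2|A IH]; intros f Hf.
  - destruct (Hf X) as [[m ->]|Hn].
    + left. now exists (TVar m).
    + right. intros [m| | |]; try discriminate. intros [=]. now apply (Hn m).
  - destruct (IH1 f Hf) as [[B1 ->]|Hn].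
    + destruct (IH2 f Hf) as [[B2 ->]|Hn].
      * left. now exists (TImp B1 B2).
      * right. intros [|B B'| |]; try discriminate. intros [=]. now apply (Hn B').
    + right. intros [|B B'| |]; try discriminate. intros [=]. now apply (Hn B).
  - destruct (IH1 f Hf) as [[B1 ->]|Hn].
    + destruct (IH2 f Hf) as [[B2 ->]|Hn].
      * left. now exists (TAnd B1 B2).
      * right. intros [| |B B'|]; try discriminate. intros [=]. now apply (Hn B').
    + right. intros [| |B B'|]; try discriminate. intros [=]. now apply (Hn B).
  - destruct (IH (up_ren f)) as [[B ->]|Hn].
    + intros [|n].
      * left. now exists 0.
      * destruct (Hf n) as [[m ->]|Hn].
        -- left. now exists (S m).
        -- right. intros [|m]; cbn; try discriminate. intros [=]. now apply (Hn m).
    + left. now exists (TAll B).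
    + right. intros [| | |B]; try discriminate. intros [=]. now apply (Hn B).
Qed.

Lemma shift_ty_dec A : {A' | A = shift_ty A'} + {forall A', A <> shift_ty A'}.
Proof.
  apply ren_ty_image_dec. intros [|n].
  - right. discriminate.
  - left. now exists n.
Qed.

Definition is_or (T : ty) : Prop := exists A B, T = TOr A B.

Lemma is_or_dec T : {is_or T} + {~ is_or T}.
Proof.
  destruct T as [| | |[|T T'| |]]; try (right; now intros (? & ? & ?)).
  destruct T as [| |[|T1 U1| |] [|T2 U2| |]|]; try (right; now intros (? & ? & ?)).
  destruct (shift_ty_dec T1) as [[A ->]|H];
    [|right; intros (A' & B' & [=]); now apply (H A')].
  destruct (shift_ty_dec T2) as [[B ->]|H];
    [|right; intros (A' & B' & [=]); now apply (H B')].
  destruct (eq_ty_dec U1 (TVar 0)) as [->|H];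
    [|right; now intros (A' & B' & [=])].
  destruct (eq_ty_dec U2 (TVar 0)) as [->|H];
    [|right; now intros (A' & B' & [=])].
  destruct (eq_ty_dec T' (TVar 0)) as [->|H];
    [|right; now intros (A' & B' & [=])].
  left. now exists A, B.
Qed.

Lemma is_or_ren xi T : is_or (ren_ty xi T) <-> is_or T.
Proof.
  split.
  - intros (A & B & E). eapply ren_ty_or_inv, E.
  - intros (A & B & ->). rewrite ren_ty_or. now exists (ren_ty xi A), (ren_ty xi B).
Qed.

Lemma bot_ren xi T : ren_ty xi T = TBot <-> T = TBot.
Proof.
  split; [|now intros ->].
  destruct T as [| | |[[|X]| | |]]; try discriminate; auto.
Qed.

(** This flag is computed from the head before normalization and handed to [app_or] as a boolean, so
    that [app_or] refers to no environment and commutes with every renaming. *)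
Definition or_head (G : env) (H : tm) : bool :=
  match H with
  | TApp M _ => if is_or_dec (infer G M) then true else false
  | _ => false
  end.

(** On typed applications the argument's type makes the annotations of the branches agree with the
    disjuncts of the head's type, so inspecting shapes is enough. *)
Definition app_or (b : bool) (H R : tm) : tm :=
  match R with
  | Pair (Lam A P) (Lam B Q) =>
      match H with
      | TApp M C => if b then case_at M A P B Q C else App H R
      | _ => App H R
      end
  | _ => App H R
  end.

(* The branches of a varrho-redex may only appear after the argument has been normalized,
   by contracting a rho-redex, so [app_or] inspects normal forms. *)
Fixpoint nf (G : env) (M : tm) : tm :=
  match M with
  | Var x => Var x
  | Lam A M => Lam A (nf (A :: G) M)
  | App M N => app_or (or_head G M) (nf G M) (nf G N)
  | Pair M N => Pair (nf G M) (nf G N)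
  | Proj M i => Proj (nf G M) i
  | TLam M => TLam (nf (map shift_ty G) M)
  | TApp M B =>
      if eq_ty_dec (infer G M) TBot then abort_at (nf G M) B else TApp (nf G M) B
  end.

Lemma or_head_or G M A B C : typed G M (TOr A B) -> or_head G (TApp M C) = true.
Proof.
  intros HM. simpl. rewrite (infer_typed _ _ _ HM).
  destruct is_or_dec as [|n]; auto. destruct n. now exists A, B.
Qed.

Lemma or_head_bot G M C : typed G M TBot -> or_head G (TApp M C) = false.
Proof.
  intros HM. simpl. rewrite (infer_typed _ _ _ HM).
  destruct is_or_dec as [(A & B & E)|]; auto. discriminate E.
Qed.

Lemma nf_or G M A B C : typed G M (TOr A B) -> nf G (TApp M C) = TApp (nf G M) C.
Proof.
  intros HM. simpl. rewrite (infer_typed _ _ _ HM).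
  destruct eq_ty_dec as [E|]; auto. discriminate E.
Qed.

Lemma nf_bot G M C : typed G M TBot -> nf G (TApp M C) = abort_at (nf G M) C.
Proof. intros HM. simpl. now rewrite (infer_typed _ _ _ HM). Qed.

Lemma nf_app G M N : nf G (App M N) = app_or (or_head G M) (nf G M) (nf G N).
Proof. reflexivity. Qed.

Lemma nf_app_var G M x : nf G (App M (Var x)) = App (nf G M) (Var x).
Proof. reflexivity. Qed.

Lemma nf_lam G A M : nf G (Lam A M) = Lam A (nf (A :: G) M).
Proof. reflexivity. Qed.

Lemma nf_tlam G M : nf G (TLam M) = TLam (nf (map shift_ty G) M).
Proof. reflexivity. Qed.

Lemma nf_pair G M N : nf G (Pair M N) = Pair (nf G M) (nf G N).
Proof. reflexivity. Qed.

Lemma nf_proj G M i : nf G (Proj M i) = Proj (nf G M) i.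
Proof. reflexivity. Qed.

Lemma nf_case G M A B P Q C : typed G M (TOr A B) ->
  nf G (App (TApp M C) (Pair (Lam A P) (Lam B Q))) =
  case_at (nf G M) A (nf (A :: G) P) B (nf (B :: G) Q) C.
Proof.
  intros HM. rewrite nf_app, (or_head_or _ _ _ _ _ HM), (nf_or _ _ _ _ _ HM). reflexivity.
Qed.

(** * Normalization commutes with renaming *)

Lemma ren_app_or xi zeta b H R :
  ren_tm xi zeta (app_or b H R) = app_or b (ren_tm xi zeta H) (ren_tm xi zeta R).
Proof.
  destruct R as [| | |[] []| | |]; try reflexivity.
  destruct H; try reflexivity. destruct b; try reflexivity. apply ren_case_at.
Qed.

Lemma or_head_ren G G' M A xi zeta :
  typed G M A -> ren_env xi zeta G G' ->
  or_head G' (ren_tm xi zeta M) = or_head G M.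
Proof.
  intros HM HG. destruct HM as [| | | | | |G A0 M B HM]; auto. simpl.
  rewrite (infer_typed _ _ _ HM), (infer_typed _ _ _ (typed_ren _ _ _ HM _ _ _ HG)).
  destruct (is_or_dec (TAll A0)) as [H|H], (is_or_dec (ren_ty xi (TAll A0))) as [H'|H'];
    auto; now rewrite is_or_ren in H'.
Qed.

(** Renaming preserves and reflects the types [TOr] and [TBot] of heads, so [nf] takes the same
    decisions on both sides. Contracta contain weakened copies of the parts of the redex, and this
    is how their normal forms are computed. *)
Lemma nf_ren G M A : typed G M A -> forall xi zeta G', ren_env xi zeta G G' ->
  nf G' (ren_tm xi zeta M) = ren_tm xi zeta (nf G M).
Proof.
  induction 1; intros xi zeta G' HG; simpl; f_equal; auto.
  - apply IHtyped. now apply ren_env_up.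
  - rewrite ren_app_or, IHtyped1, IHtyped2 by auto. f_equal.
    eapply or_head_ren; eauto.
  - apply IHtyped. now apply ren_env_shift.
  - rewrite (infer_typed _ _ _ H), (infer_typed _ _ _ (typed_ren _ _ _ H _ _ _ HG)).
    rewrite IHtyped by auto.
    destruct (eq_ty_dec (TAll A) TBot) as [e|e],
      (eq_ty_dec (ren_ty xi (TAll A)) TBot) as [e'|e'];
      rewrite ?ren_abort_at; auto; now rewrite bot_ren in e'.
Qed.

Lemma nf_shift G M A B : typed G M A -> nf (B :: G) (shift_tm M) = shift_tm (nf G M).
Proof. intros H. eapply nf_ren; eauto using ren_env_weaken. Qed.

Lemma nf_shift1 G M A B C : typed (B :: G) M A ->
  nf (B :: C :: G) (shift1_tm M) = shift1_tm (nf (B :: G) M).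
Proof. intros H. eapply nf_ren; eauto using ren_env_weaken1. Qed.

Lemma nf_tshift G M A : typed G M A ->
  nf (map shift_ty G) (tshift_tm M) = tshift_tm (nf G M).
Proof. intros H. eapply nf_ren; eauto. apply ren_env_tweaken. Qed.

Lemma nf_tapp_var G M X : nf G (TApp M (TVar X)) = TApp (nf G M) (TVar X).
Proof. simpl. now destruct eq_ty_dec. Qed.

(** Normalizing the redex unfolds [case_at] along the whole instantiating type, and contracting it
    performs the first unfolding. The eliminations added to the branches are projections,
    applications to a variable and instantiations with a variable, which [nf] leaves in place. *)
Lemma nf_varrho G M A B N N' T :
  typed G M (TOr A B) -> varrho M A B N N' -> typed G N T -> nf G N = nf G N'.
Proof.
  intros HM HN HT.
  assert (HS : typed (map shift_ty G) (tshift_tm M) (TOr (shift_ty A) (shift_ty B))).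
  { unfold shift_ty at 2 3. rewrite <- ren_ty_or. now apply typed_tshift. }
  destruct HN; rewrite nf_case by auto; apply (typed_or_elim_inv _ _ _ _ _ _ _ HM) in HT;
    destruct HT as [-> HR]; repeat inv_typed; cbn [case_at].
  - rewrite nf_lam, nf_case by (apply typed_shift; auto).
    rewrite !nf_app_var. erewrite nf_shift, !nf_shift1 by eassumption. reflexivity.
  - rewrite nf_pair, !nf_case, !nf_proj by auto. reflexivity.
  - rewrite nf_tlam, nf_case, !nf_tapp_var by auto.
    erewrite nf_tshift by eassumption.
    erewrite <- !(nf_tshift (_ :: _)) by eassumption. reflexivity.
Qed.

Lemma nf_rho G M N N' : typed G M TBot -> rho M N N' -> nf G N = nf G N'.
Proof.
  intros HM HN. destruct HN; rewrite nf_bot by auto; cbn [abort_at].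
  - rewrite nf_lam, nf_bot by (apply typed_shift; auto).
    now erewrite nf_shift by eassumption.
  - now rewrite nf_pair, !nf_bot.
  - rewrite nf_tlam, nf_bot by now apply (typed_tshift _ _ TBot).
    now erewrite nf_tshift by eassumption.
Qed.

(** * Invariance of typing and normal forms under fine reduction *)

Lemma nf_tapp_eq G M M' A C : typed G M A -> typed G M' A ->
  nf G M = nf G M' -> nf G (TApp M C) = nf G (TApp M' C).
Proof.
  intros H H' E. simpl. now rewrite (infer_typed _ _ _ H), (infer_typed _ _ _ H'), E.
Qed.

(** Renaming the derivation by [eta] cancels [xi] in the term. *)
Lemma typed_unren G xi eta M A : (forall X, eta (xi X) = X) ->
  typed G (ren_tm xi (fun x => x) M) A -> typed (map (ren_ty eta) G) M (ren_ty eta A).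
Proof.
  intros H HM.
  pose proof (typed_ren _ _ _ HM _ _ _ (ren_env_tweaken eta G)) as HM'.
  rewrite ren_tm_comp in HM'. now rewrite ren_tm_id in HM'.
Qed.

(** Only the outer form of [T] is recovered: [eta] may identify variables, so the disjuncts of [T]
    are not determined by [A] and [B]. *)
Lemma typed_unren_or G xi eta M T A B : (forall X, eta (xi X) = X) ->
  typed (map (ren_ty eta) G) M (TOr A B) ->
  typed G (ren_tm xi (fun x => x) M) T -> is_or T.
Proof.
  intros H HM HT. apply (is_or_ren eta). exists A, B.
  eapply typed_unique; [|exact HM]. now apply (typed_unren _ _ _ _ _ H).
Qed.

Lemma typed_unren_bot G xi eta M T : (forall X, eta (xi X) = X) ->
  typed (map (ren_ty eta) G) M TBot ->
  typed G (ren_tm xi (fun x => x) M) T -> T = TBot.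
Proof.
  intros H HM HT. apply (bot_ren eta).
  eapply typed_unique; [|exact HM]. now apply (typed_unren _ _ _ _ _ H).
Qed.

(** Once the head is known to have some disjunction type, the annotations on the branches of the
    redex determine its disjuncts. This supplies what [typed_unren_or] loses. *)
Lemma varrho_typed_inv G M A B N N' T : varrho M A B N N' -> typed G N T ->
  exists U, typed G M U /\ (is_or U -> U = TOr A B).
Proof.
  intros HN HT.
  assert (exists U, typed G M U) as [U HU] by (destruct HN; repeat inv_typed; eauto).
  exists U. split; [assumption|]. intros (A' & B' & ->).
  destruct HN; apply (typed_or_elim_inv _ _ _ _ _ _ _ HU) in HT; destruct HT as [_ HR];
    now repeat inv_typed.
Qed.

(* Fineness in [TLam_at X M] concerns [M] in an environment that may mention [X], whereas
   typing concerns a renamed copy of [M] in a weakened environment.  The left inverse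
   [eta] recovers the former from the latter. *)
Lemma fine_invariance G M M' : fine G M M' -> forall G0 xi eta T,
  (forall X, eta (xi X) = X) ->
  G = map (ren_ty eta) G0 ->
  let K := ren_tm xi (fun x => x) M in
  let K' := ren_tm xi (fun x => x) M' in
  typed G0 K T ->
  typed G0 K' T /\ nf G0 K = nf G0 K' /\ or_head G0 K = or_head G0 K'.
Proof.
  induction 1; intros G0 xi eta T Hinv HG; cbn zeta.
  - subst G. intros HT. apply (ren_varrho xi (fun x => x)) in H0.
    assert (HM : typed G0 (ren_tm xi (fun x => x) M) (TOr (ren_ty xi A) (ren_ty xi B))).
    { destruct (varrho_typed_inv _ _ _ _ _ _ _ H0 HT) as (U & HU & EU).
      rewrite <- EU; [assumption|]. eapply typed_unren_or; eauto. }
    split; [eapply typed_varrho; eauto|]. split; [eapply nf_varrho; eauto|].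
    (* The redex is an application and the contractum an introduction form, so [or_head] is false on
       both. *)
    now destruct H0.
  - subst G. intros HT. apply (ren_rho xi (fun x => x)) in H0.
    assert (HM : typed G0 (ren_tm xi (fun x => x) M) TBot).
    { assert (exists U, typed G0 (ren_tm xi (fun x => x) M) U) as [U HU]
        by (destruct H0; inv_typed; eauto).
      now rewrite (typed_unren_bot _ _ _ _ _ Hinv H HU) in HU. }
    split; [eapply typed_rho; eauto|]. split; [eapply nf_rho; eauto|].
    (* The redex is itself an instantiation, but its head has type [TBot], which is not a
       disjunction. *)
    destruct H0; rewrite or_head_bot; auto.
  - assert (HL : forall N, ren_tm xi (fun x => x) (Lam A N) =
        Lam (ren_ty xi A) (ren_tm xi (fun x => x) N)).
    { intros N. cbn [ren_tm]. f_equal. now apply ren_tm_ext; auto using up_ren_id. }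
    rewrite !HL. intros HT. inv_typed.
    destruct (IHfine (ren_ty xi A :: G0) xi eta B) as (HT & E & _); auto.
    { cbn [map]. f_equal. rewrite ren_ty_comp. symmetry. now apply ren_ty_id. }
    split; [now constructor|]. split; auto. now rewrite !nf_lam, E.
  - cbn [ren_tm]. intros HT. inv_typed.
    edestruct IHfine as (HT & E & Eh); eauto.
    split; [econstructor; eauto|]. split; auto. now rewrite !nf_app, E, Eh.
  - cbn [ren_tm]. intros HT. inv_typed.
    edestruct IHfine as (HT & E & Eh); eauto.
    split; [econstructor; eauto|]. split; auto. now rewrite !nf_app, E.
  - cbn [ren_tm]. intros HT. inv_typed.
    edestruct IHfine as (HT & E & Eh); eauto.
    split; [econstructor; eauto|]. split; auto. now rewrite !nf_pair, E.
  - cbn [ren_tm]. intros HT. inv_typed.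
    edestruct IHfine as (HT & E & Eh); eauto.
    split; [econstructor; eauto|]. split; auto. now rewrite !nf_pair, E.
  - cbn [ren_tm]. intros HT. inv_typed.
    edestruct IHfine as (HT & E & Eh); eauto.
    split; [econstructor; eauto|]. split; auto. now rewrite !nf_proj, E.
  - unfold TLam_at. cbn [ren_tm]. rewrite !ren_tm_comp. intros HT. inv_typed.
    (* The new left inverse sends the bound variable 0 back to the name [X] and acts as [eta] on the
       others. Composed with the shift it is [eta] again, so the environment of [M] is matched even
       when it mentions [X]. *)
    destruct (IHfine (map shift_ty G0) (fun Y => up_ren xi (bind X Y)) (scons X eta) A)
      as (HT & E & _); auto.
    + intros Y. unfold bind. destruct (Nat.eqb_spec Y X); cbn; auto.
    + rewrite map_map. apply map_ext. intros C. unfold shift_ty. now rewrite ren_ty_comp.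
    + split; [now constructor|]. split; auto. now rewrite !nf_tlam, E.
  - cbn [ren_tm]. intros HT. inv_typed.
    edestruct IHfine as (HT & E & Eh); eauto.
    split; [now constructor|]. split; [now apply nf_tapp_eq with (A := TAll A)|].
    simpl. erewrite !infer_typed by eassumption. reflexivity.
Qed.

Lemma fine_preserves G M M' T : fine G M M' -> typed G M T ->
  typed G M' T /\ nf G M = nf G M'.
Proof.
  intros HF HT.
  destruct (fine_invariance _ _ _ HF G (fun X => X) (fun X => X) T) as (HT' & E & _); auto.
  - rewrite <- (map_id G) at 1. apply map_ext. intros A. symmetry. now apply ren_ty_id.
  - now rewrite ren_tm_id.
  - rewrite !ren_tm_id in E by auto. now rewrite ren_tm_id in HT'.
Qed.

Lemma fine_steps_preserves G M M' T : fine_steps G M M' -> typed G M T ->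
  typed G M' T /\ nf G M = nf G M'.
Proof.
  induction 1 as [M M' H|M|M1 M2 M3 _ IH1 _ IH2]; intros HT.
  - now apply fine_preserves.
  - auto.
  - destruct (IH1 HT) as [HT2 E]. rewrite E. auto.
Qed.

(** * Weakening of fine reductions *)

(** Injectivity keeps the binder for [xi X] from capturing the image of a variable other than
    [X]. *)
Lemma bind_ren xi X Y : (forall m n, xi m = xi n -> m = n) ->
  up_ren xi (bind X Y) = bind (xi X) (xi Y).
Proof.
  intros H. unfold bind. destruct (Nat.eqb_spec Y X) as [->|HY].
  - now rewrite Nat.eqb_refl.
  - now destruct (Nat.eqb_spec (xi Y) (xi X)) as [E|]; [apply H in E|].
Qed.

Lemma ren_TLam_at xi zeta X M : (forall m n, xi m = xi n -> m = n) ->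
  ren_tm xi zeta (TLam_at X M) = TLam_at (xi X) (ren_tm xi zeta M).
Proof.
  intros H. unfold TLam_at. cbn [ren_tm]. rewrite !ren_tm_comp. f_equal.
  apply ren_tm_ext; auto. intros Y. now apply bind_ren.
Qed.

Lemma fine_ren G M M' : fine G M M' -> forall xi zeta G',
  (forall m n, xi m = xi n -> m = n) -> ren_env xi zeta G G' ->
  fine G' (ren_tm xi zeta M) (ren_tm xi zeta M').
Proof.
  induction 1; intros xi zeta G' Hxi HG;
    [| | | | | | | |rewrite !ren_TLam_at by auto|]; cbn [ren_tm];
    try (constructor; auto using ren_env_up; fail).
  - eapply fine_varrho; [|apply ren_varrho; eassumption].
    rewrite <- ren_ty_or. eapply typed_ren; eauto.
  - eapply fine_rho; [|apply ren_rho; eassumption].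
    now apply (typed_ren _ _ _ H).
Qed.

(** Freshness stated through renamings: [N] bounds the free variables, hence is itself a fresh
    name. *)
Lemma ty_support A : exists N, forall f g, (forall n, n < N -> f n = g n) ->
  ren_ty f A = ren_ty g A.
Proof.
  induction A as [X|A [N HN] B [K HK]|A [N HN] B [K HK]|A [N HN]].
  - exists (S X). intros f g H. cbn. f_equal. apply H. lia.
  - exists (N + K). intros f g H. cbn. f_equal; [apply HN|apply HK]; intros; apply H; lia.
  - exists (N + K). intros f g H. cbn. f_equal; [apply HN|apply HK]; intros; apply H; lia.
  - exists N. intros f g H. cbn. f_equal. apply HN. intros [|n] Hn; cbn; auto.
    rewrite H; [reflexivity|lia].
Qed.

Lemma tm_support M : exists N, forall f g zeta, (forall n, n < N -> f n = g n) ->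
  ren_tm f zeta M = ren_tm g zeta M.
Proof.
  induction M as [x|A M [N HN]|M [N HN] M' [K HK]|M [N HN] M' [K HK]|M [N HN] i|
                  M [N HN]|M [N HN] B].
  - now exists 0.
  - destruct (ty_support A) as [K HK]. exists (N + K). intros f g zeta H. cbn.
    f_equal; [apply HK|apply HN]; intros; apply H; lia.
  - exists (N + K). intros f g zeta H. cbn.
    f_equal; [apply HN|apply HK]; intros; apply H; lia.
  - exists (N + K). intros f g zeta H. cbn.
    f_equal; [apply HN|apply HK]; intros; apply H; lia.
  - exists N. intros f g zeta H. cbn. f_equal. now apply HN.
  - exists N. intros f g zeta H. cbn. f_equal. apply HN. intros [|n] Hn; cbn; auto.
    rewrite H; [reflexivity|lia].
  - destruct (ty_support B) as [K HK]. exists (N + K). intros f g zeta H. cbn.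
    f_equal; [apply HN|apply HK]; intros; apply H; lia.
Qed.

Lemma env_support (G : env) : exists N, forall f g, (forall n, n < N -> f n = g n) ->
  map (ren_ty f) G = map (ren_ty g) G.
Proof.
  induction G as [|A G [N HN]].
  - now exists 0.
  - destruct (ty_support A) as [K HK]. exists (N + K). intros f g H. cbn.
    f_equal; [apply HK|apply HN]; intros; apply H; lia.
Qed.

(* The cycle (0 N N-1 ... 1): the injective renaming that gives the bound variable 0 the
   fresh name [N] and undoes the weakening of the other variables up to [N]. *)
Definition unbind (N n : nat) : nat :=
  if Nat.eqb n 0 then N else if Nat.leb n N then pred n else n.

Lemma unbind_inj N m n : unbind N m = unbind N n -> m = n.
Proof.
  unfold unbind.
  destruct (Nat.eqb_spec m 0), (Nat.eqb_spec n 0),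
    (Nat.leb_spec m N), (Nat.leb_spec n N); lia.
Qed.

Lemma bind_unbind N n : n < N -> bind N (unbind N n) = n.
Proof.
  intros H. unfold bind, unbind. destruct (Nat.eqb_spec n 0) as [->|].
  - now rewrite Nat.eqb_refl.
  - destruct (Nat.leb_spec n N); destruct (Nat.eqb_spec (pred n) N); lia.
Qed.

Lemma unbind_S N n : n < N -> unbind N (S n) = n.
Proof. intros H. unfold unbind. cbn [Nat.eqb]. destruct (Nat.leb_spec (S n) N); lia. Qed.

(** This recovers the usual rule for a fresh bound variable. With [N] fresh for both bodies and the
    environment, the bound variable is given the name [N] by the injective [unbind N], fineness is
    transported along it, and [N] is abstracted again. *)
Lemma fine_tlam_shift G M M' : fine (map shift_ty G) M M' -> fine G (TLam M) (TLam M').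
Proof.
  intros H. destruct (tm_support M) as [N1 H1], (tm_support M') as [N2 H2],
    (env_support G) as [N3 H3].
  set (N := N1 + N2 + N3).
  assert (HL : forall K, (forall f g zeta, (forall n, n < N -> f n = g n) ->
      ren_tm f zeta K = ren_tm g zeta K) ->
    TLam K = TLam_at N (ren_tm (unbind N) (fun x => x) K)).
  { intros K HK. unfold TLam_at. rewrite ren_tm_comp. f_equal.
    rewrite (HK _ (fun X => X)) by (intros; now apply bind_unbind).
    symmetry. now apply ren_tm_id. }
  rewrite (HL M) by (intros; apply H1; intros; apply H0; unfold N; lia).
  rewrite (HL M') by (intros; apply H2; intros; apply H0; unfold N; lia).
  constructor. apply (fine_ren _ _ _ H); [apply unbind_inj|].
  (* On the free variables of [G], all below [N], [unbind N] cancels the shift. *)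
  replace G with (map (ren_ty (unbind N)) (map shift_ty G)) at 2; [apply ren_env_tweaken|].
  rewrite map_map. transitivity (map (ren_ty (fun n => n)) G).
  - rewrite (H3 (fun n => n) (fun n => unbind N (S n)))
      by (intros; rewrite unbind_S; unfold N; lia).
    apply map_ext. intros A. apply ren_ty_comp.
  - rewrite <- (map_id G) at 2. apply map_ext. intros A. now apply ren_ty_id.
Qed.

(** * Reduction of the Russell-Prawitz translation to the atomic one *)

Lemma clos_rt_map {T : Type} (R R' : T -> T -> Prop) (f : T -> T) :
  (forall x y, R x y -> R' (f x) (f y)) ->
  forall x y, clos_refl_trans T R x y -> clos_refl_trans T R' (f x) (f y).
Proof. intros H x y. induction 1; eauto using clos_refl_trans. Qed.

(** Each clause of [case_at] is one root [varrho] step followed by recursion inside the contractum,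
    whose instantiating types are smaller. *)
Lemma case_at_steps C : forall M A P B Q,
  steps (App (TApp M C) (Pair (Lam A P) (Lam B Q))) (case_at M A P B Q C).
Proof.
  induction C; intros M A P B Q; cbn [case_at].
  - apply rt_refl.
  - eapply rt_trans; [eapply rt_step, step_varrho, varrho_imp|].
    eapply clos_rt_map, IHC2. eauto using step.
  - eapply rt_trans; [eapply rt_step, step_varrho, varrho_and|].
    eapply rt_trans.
    + eapply (clos_rt_map _ _ (fun N => Pair N _)), IHC1. eauto using step.
    + eapply clos_rt_map, IHC2. eauto using step.
  - eapply rt_trans; [eapply rt_step, step_varrho, varrho_all|].
    eapply clos_rt_map, IHC. eauto using step.
Qed.

Lemma abort_at_steps C : forall M, steps (TApp M C) (abort_at M C).
Proof.
  induction C; intros M; cbn [abort_at].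
  - apply rt_refl.
  - eapply rt_trans; [eapply rt_step, step_rho, rho_imp|].
    eapply clos_rt_map, IHC2. eauto using step.
  - eapply rt_trans; [eapply rt_step, step_rho, rho_and|].
    eapply rt_trans.
    + eapply (clos_rt_map _ _ (fun N => Pair N _)), IHC1. eauto using step.
    + eapply clos_rt_map, IHC2. eauto using step.
  - eapply rt_trans; [eapply rt_step, step_rho, rho_all|].
    eapply clos_rt_map, IHC. eauto using step.
Qed.

Lemma bullet_steps_circ M : steps (bullet M) (circ M).
Proof.
  induction M; cbn [bullet circ].
  - apply rt_refl.
  - eapply clos_rt_map, IHM. eauto using step.
  - eapply rt_trans.
    + eapply (clos_rt_map _ _ (fun N => App N _)), IHM1. eauto using step.
    + eapply clos_rt_map, IHM2. eauto using step.
  - eapply rt_trans.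
    + eapply (clos_rt_map _ _ (fun N => Pair N _)), IHM1. eauto using step.
    + eapply clos_rt_map, IHM2. eauto using step.
  - eapply (clos_rt_map _ _ (fun N => Proj N _)), IHM. eauto using step.
  - eapply (clos_rt_map _ _ (fun N => tr_inj i N _ _)), IHM.
    intros. unfold tr_inj, shift_tm, tshift_tm. eauto 8 using step, step_ren.
  - eapply rt_trans; [|apply case_at_steps].
    eapply rt_trans.
    { eapply (clos_rt_map _ _ (fun N => App (TApp N _) _)), IHM1. eauto using step. }
    eapply rt_trans.
    { eapply (clos_rt_map _ _ (fun N => App _ (Pair (Lam _ N) _))), IHM2.
      eauto using step. }
    eapply (clos_rt_map _ _ (fun N => App _ (Pair _ (Lam _ N)))), IHM3.
    eauto using step.
  - eapply rt_trans; [|apply abort_at_steps].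
    eapply (clos_rt_map _ _ (fun N => TApp N _)), IHM. eauto using step.
Qed.

(** * Fineness of the reduction on typed proof terms *)

Lemma case_at_fine_steps C : forall G M A P B Q, typed G M (TOr A B) ->
  fine_steps G (App (TApp M C) (Pair (Lam A P) (Lam B Q))) (case_at M A P B Q C).
Proof.
  induction C; intros G M A P B Q HM; cbn [case_at].
  - apply rt_refl.
  - eapply rt_trans; [eapply rt_step, fine_varrho, varrho_imp; exact HM|].
    eapply clos_rt_map, IHC2; eauto using fine, typed_shift.
  - eapply rt_trans; [eapply rt_step, fine_varrho, varrho_and; exact HM|].
    eapply rt_trans.
    + eapply (clos_rt_map _ _ (fun N => Pair N _)), IHC1; eauto using fine.
    + eapply clos_rt_map, IHC2; eauto using fine.
  - eapply rt_trans; [eapply rt_step, fine_varrho, varrho_all; exact HM|].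
    eapply clos_rt_map, IHC; eauto using fine_tlam_shift.
    unfold shift_ty at 2 3. rewrite <- ren_ty_or. now apply typed_tshift.
Qed.

Lemma abort_at_fine_steps C : forall G M, typed G M TBot ->
  fine_steps G (TApp M C) (abort_at M C).
Proof.
  induction C; intros G M HM; cbn [abort_at].
  - apply rt_refl.
  - eapply rt_trans; [eapply rt_step, fine_rho, rho_imp; exact HM|].
    eapply clos_rt_map, IHC2; eauto using fine, typed_shift.
  - eapply rt_trans; [eapply rt_step, fine_rho, rho_and; exact HM|].
    eapply rt_trans.
    + eapply (clos_rt_map _ _ (fun N => Pair N _)), IHC1; eauto using fine.
    + eapply clos_rt_map, IHC2; eauto using fine.
  - eapply rt_trans; [eapply rt_step, fine_rho, rho_all; exact HM|].
    eapply clos_rt_map, IHC; eauto using fine_tlam_shift.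
    now apply (typed_tshift _ _ TBot).
Qed.

Lemma typed_tr_inj G i M A B :
  typed G M (sel i A B) -> typed G (tr_inj i M A B) (TOr A B).
Proof.
  intros HM. apply typed_tlam, typed_lam.
  eapply typed_app; [|eapply typed_shift, typed_tshift, HM].
  destruct i.
  - eapply (typed_proj _ _ _ _ one), typed_var. reflexivity.
  - eapply (typed_proj _ _ _ _ two), typed_var. reflexivity.
Qed.

Lemma bullet_typed G M A : ipc_typed G M A -> typed (tr_env G) (bullet M) (tr_ty A).
Proof.
  induction 1; cbn [bullet tr_ty].
  - constructor. unfold tr_env. now rewrite nth_error_map, H.
  - now constructor.
  - econstructor; eassumption.
  - now constructor.
  - replace (tr_ty (sel i A B)) with (sel i (tr_ty A) (tr_ty B)) by now destruct i.
    now constructor.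
  - apply typed_tr_inj. now destruct i.
  - eapply typed_or_elim; [eassumption|]. now repeat constructor.
  - now apply typed_bot_elim.
Qed.

Lemma bullet_fine_steps_circ G M A : ipc_typed G M A ->
  fine_steps (tr_env G) (bullet M) (circ M).
Proof.
  (* The steps of [case_at] and [abort_at] start once the head is [circ M], so its type is needed;
     subject reduction along the reduction from [bullet M] provides it. *)
  assert (HC : forall G M A, ipc_typed G M A -> fine_steps (tr_env G) (bullet M) (circ M) ->
    typed (tr_env G) (circ M) (tr_ty A)).
  { intros G' M' A' HT HS.
    now apply (fine_steps_preserves _ _ _ _ HS), bullet_typed. }
  induction 1; cbn [bullet circ].
  - apply rt_refl.
  - eapply clos_rt_map, IHipc_typed. eauto using fine.
  - eapply rt_trans.
    + eapply (clos_rt_map _ _ (fun N => App N _)), IHipc_typed1. eauto using fine.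
    + eapply clos_rt_map, IHipc_typed2. eauto using fine.
  - eapply rt_trans.
    + eapply (clos_rt_map _ _ (fun N => Pair N _)), IHipc_typed1. eauto using fine.
    + eapply clos_rt_map, IHipc_typed2. eauto using fine.
  - eapply (clos_rt_map _ _ (fun N => Proj N _)), IHipc_typed. eauto using fine.
  - eapply (clos_rt_map _ _ (fun N => tr_inj i N _ _)), IHipc_typed.
    intros N N' HN. apply fine_tlam_shift, fine_lam, fine_appr.
    (* The two weakenings of [tr_inj] are undone in turn: first the term variable [w], then the type
       variable [X]. *)
    eapply (fine_ren (map shift_ty (tr_env G))); [|auto|apply ren_env_weaken].
    eapply fine_ren; [exact HN|auto|apply ren_env_tweaken].
  - eapply rt_trans; [|eapply case_at_fine_steps, (HC _ _ (IOr A B)); assumption].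
    eapply rt_trans.
    { eapply (clos_rt_map _ _ (fun N => App (TApp N _) _)), IHipc_typed1.
      eauto using fine. }
    eapply rt_trans.
    { eapply (clos_rt_map _ _ (fun N => App _ (Pair (Lam _ N) _))), IHipc_typed2.
      eauto using fine. }
    eapply (clos_rt_map _ _ (fun N => App _ (Pair _ (Lam _ N)))), IHipc_typed3.
    eauto using fine.
  - eapply rt_trans; [|eapply abort_at_fine_steps, (HC _ _ IBot); assumption].
    eapply (clos_rt_map _ _ (fun N => TApp N _)), IHipc_typed. eauto using fine.
Qed.

(** * Normal forms *)

(** These are the raw terms of the fragment $\mathbf{F}_{\mathbf{at}}$. *)
Fixpoint atomic (M : tm) : Prop :=
  match M with
  | Var _ => True
  | Lam _ M | Proj M _ | TLam M => atomic M
  | App M N | Pair M N => atomic M /\ atomic N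
  | TApp M B => atomic M /\ exists X, B = TVar X
  end.

Lemma atomic_ren M : forall xi zeta, atomic (ren_tm xi zeta M) <-> atomic M.
Proof.
  induction M; cbn [ren_tm atomic]; intros xi zeta; try tauto; try apply IHM.
  - now rewrite IHM1, IHM2.
  - now rewrite IHM1, IHM2.
  - rewrite IHM. split; intros [H [X E]]; split; auto.
    + destruct B; try discriminate E. eauto.
    + subst. cbn. eauto.
Qed.

Lemma atomic_case_at C : forall M A P B Q,
  atomic M -> atomic P -> atomic Q -> atomic (case_at M A P B Q C).
Proof.
  induction C; intros M A P B Q HM HP HQ; cbn [case_at atomic]; eauto 6.
  - apply IHC2; cbn [atomic]; unfold shift_tm, shift1_tm; now rewrite ?atomic_ren.
  - apply IHC; cbn [atomic]; unfold tshift_tm; rewrite ?atomic_ren; eauto.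
Qed.

Lemma atomic_abort_at C : forall M, atomic M -> atomic (abort_at M C).
Proof.
  induction C; intros M HM; cbn [abort_at atomic]; eauto.
  - apply IHC2. now apply atomic_ren.
  - apply IHC. now apply atomic_ren.
Qed.

Lemma atomic_circ M : atomic (circ M).
Proof.
  induction M; cbn [circ atomic]; auto using atomic_case_at, atomic_abort_at.
  cbn. split; auto. now apply atomic_ren, atomic_ren.
Qed.

(** Every redex of either kind instantiates with a compound type, and no such instantiation occurs
    in an atomic term. *)
Lemma atomic_fine_nf G M : atomic M -> fine_nf G M.
Proof.
  intros HM M' HF. revert HM.
  induction HF as [G M A B N N' _ []|G M N N' _ []| | | | | | |G X M M' _ IH|];
    cbn [atomic]; try tauto.
  1-6: intros H; decompose [and ex] H; discriminate.
  unfold TLam_at. cbn [atomic]. now rewrite atomic_ren.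
Qed.

(** By induction [nf] fixes the immediate subterms, so it could change the term only by a conversion
    at the root, and this would be a fine step. *)
Lemma nf_fine_nf G M A : typed G M A -> fine_nf G M -> nf G M = M.
Proof.
  unfold fine_nf. intros HM. induction HM; intros HF.
  - reflexivity.
  - rewrite nf_lam, IHHM; auto. intros M' H. eapply HF, fine_lam, H.
  - rewrite nf_app, IHHM1, IHHM2 by (intros ? ?; eapply HF; eauto using fine).
    destruct N as [| | |[|A1 P| | | | |] [|B1 Q| | | | |]| | |]; try reflexivity.
    destruct M as [| | | | | |M C]; try reflexivity.
    cbn [app_or]. destruct (or_head G (TApp M C)) eqn:E; [|reflexivity].
    cbn in E. destruct is_or_dec as [(A' & B' & E')|]; [|discriminate E].
    assert (HM : typed G M (TOr A' B')).
    { inversion HM1; subst. rewrite <- E'. now erewrite infer_typed by eassumption. }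
    assert (HT : typed G (App (TApp M C) (Pair (Lam A1 P) (Lam B1 Q))) B)
      by (econstructor; eassumption).
    apply (typed_or_elim_inv _ _ _ _ _ _ _ HM) in HT as [_ HR].
    repeat inv_typed.
    (* For a type variable [case_at] rebuilds the very same application; for any other type the root
       is a fine [varrho]-redex, whose annotations have just been identified with the disjuncts. *)
    destruct C; [reflexivity|exfalso..]; eapply HF, fine_varrho; eauto using varrho.
  - rewrite nf_pair, IHHM1, IHHM2; auto; intros ? ?; eapply HF; eauto using fine.
  - rewrite nf_proj, IHHM; auto. intros ? ?. eapply HF; eauto using fine.
  - rewrite nf_tlam, IHHM; auto. intros M' H. eapply HF, fine_tlam_shift, H.
  - cbn [nf]. rewrite IHHM by (intros ? ?; eapply HF; eauto using fine).
    rewrite (infer_typed _ _ _ HM). destruct eq_ty_dec as [E|]; [|reflexivity].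
    rewrite E in HM.
    destruct B; [reflexivity|exfalso..]; eapply HF, fine_rho; eauto using rho.
Qed.

Theorem proposition8 :
  forall M : proof,
    steps (bullet M) (circ M) /\
    forall G : ipc_env, ipc_typable G M ->
      fine_steps (tr_env G) (bullet M) (circ M) /\
      is_atomic_nf (tr_env G) (bullet M) (circ M).
Proof.
  intros M. split; [apply bullet_steps_circ|]. intros G [A HM].
  pose proof (bullet_fine_steps_circ _ _ _ HM) as HS.
  pose proof (atomic_fine_nf (tr_env G) _ (atomic_circ M)) as HN.
  split; [exact HS|]. split; [now split|]. intros N' [HS' HN'].
  apply bullet_typed in HM.
  destruct (fine_steps_preserves _ _ _ _ HS HM) as [HT E].
  destruct (fine_steps_preserves _ _ _ _ HS' HM) as [HT' E'].
  (* Both terms are typed and fine normal, hence fixed by [nf], and both have the same [nf] as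
     [bullet M]. *)
  rewrite <- (nf_fine_nf _ _ _ HT HN), <- (nf_fine_nf _ _ _ HT' HN'). congruence.
Qed.
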